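(* Every positive enumerable functor $F:\mathfrak{C}\to\mathfrak{D}$ between classes of structures is positive $\star$-enumerable.
   Context: Structures: all structures are countable with universe $\omega$, in a relational language $(R_i)_{i\in\omega}$ where $R_i$ has arity $a_i$ and $i\mapsto a_i$ is computable. A class of structures (in a fixed language) is viewed as a category whose morphisms are the isomorphisms between its members; $Hom(\mathcal{A},\mathcal{B})$ is the set of isomorphisms from $\mathcal{A}$ to $\mathcal{B}$. The languages of $\mathfrak{C}$ and $\mathfrak{D}$ may differ. A functor maps structures to structures and isomorphisms $f:\mathcal{A}\to\mathcal{B}$ to isomorphisms $F(f):F(\mathcal{A})\to F(\mathcal{B})$, preserving composition and identities. Coding: tuples of natural numbers are coded by numbers via a fixed computable coding $\langle\cdot\rangle$, and $\oplus$ and $\bigoplus_{i\in\omega}$ denote the usual effective joins of sets. $Graph(f)=\{\langle x,y\rangle: f(x)=y\}$. The positive diagram of $\mathcal{A}$ is $P(\mathcal{A})={=}\oplus{\neq}\oplus\bigoplus_{i\in\omega}R_i^{\mathcal{A}}$, where $=$ and $\neq$ are equality and inequality on $\omega$. An enumeration operator $\Psi$ is a c.e. set of pairs $(E,x)$ with $E$ (a code of) a finite set, and $\Psi^X=\{x:\exists E\subseteq X\ (E,x)\in\Psi\}$. A Turing operator $\Phi$ satisfies $\Phi^X=Y$ if it computes the characteristic function of $Y$ from the oracle $X$. A functor $F:\mathfrak{C}\to\mathfrak{D}$ is positive enumerable if there are enumeration operators $\Psi,\Psi_*$ such that for all $\mathcal{A},\mathcal{B}\in\mathfrak{C}$: (1)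 $\Psi^{P(\mathcal{A})}=P(F(\mathcal{A}))$; (2) for all $f\in Hom(\mathcal{A},\mathcal{B})$, $\Psi_*^{P(\mathcal{A})\oplus Graph(f)\oplus P(\mathcal{B})}=Graph(F(f))$. A functor $F:\mathfrak{C}\to\mathfrak{D}$ is positive $\star$-enumerable if there are an enumeration operator $\Psi$ and a Turing operator $\Phi_*$ such that for all $\mathcal{A},\mathcal{B}\in\mathfrak{C}$: (1) $\Psi^{P(\mathcal{A})}=P(F(\mathcal{A}))$; (2) for all $f\in Hom(\mathcal{A},\mathcal{B})$, $\Phi_*^{P(\mathcal{A})\oplus Graph(f)\oplus P(\mathcal{B})}=Graph(F(f))$. *)

(* Defs.v *)
From mathcomp Require Import all_boot.
From mathcomp Require Import boolp classical_sets.
From Stdlib Require Cantor.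

Set Implicit Arguments.
Unset Strict Implicit.
Unset Printing Implicit Defensive.

Local Open Scope classical_set_scope.
Local Open Scope nat_scope.

Definition pairing (x y : nat) : nat := Cantor.to_nat (x, y).
Arguments pairing : simpl never.
Notation "'⟨' x , y '⟩'" := (pairing x y)
  (at level 0, x at level 99, y at level 99, format "'⟨' x ,  y '⟩'").

(* <x> = x and <x_0, ..., x_n> = <x_0, <x_1, ..., x_n>>, so that on 2-tuples
   this is Cantor pairing; the empty tuple is sent to 0.  The map is injective
   on the tuples of each fixed length. *)
Fixpoint tuple_code (s : seq nat) : nat :=
  match s with
  | [::] => 0
  | [:: x] => x
  | x :: s' => ⟨x, tuple_code s'⟩
  end.

(* The finite set with canonical index u : u is the sum of the 2 ^ i for i in
   finset_of_code u. *)
Definition finset_of_code (u : nat) : set nat := [set i | odd (u %/ 2 ^ i)].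

Definition join (A B : set nat) : set nat :=
  [set x.*2 | x in A] `|` [set x.*2.+1 | x in B].
Notation "A ⊕ B" := (join A B) (at level 50, left associativity).

Definition bigjoin (A : nat -> set nat) : set nat :=
  [set n | exists i x, n = ⟨i, x⟩ /\ A i x].

Definition Graph (f : nat -> nat) : set nat :=
  [set n | exists x y, n = ⟨x, y⟩ /\ f x = y].

(* Programs for the partial functions nat -> nat that are recursive in an
   oracle.  These are Kleene's schemes restricted to unary functions: the
   Cantor pairing and its two projections replace functions of several
   arguments. *)
Inductive code : Type :=
  | Zero
  | Succ
  | Fst
  | Snd
  | Oracle
  | Pair (c d : code)
  | Comp (c d : code)
  | Prec (c d : code)
  | Mu (c : code).

(* [eval X c n m] : with oracle X, the program c halts on input n with
   output m.  The boolean (n \in X) is coerced to 0 or 1. *)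
Inductive eval (X : set nat) : code -> nat -> nat -> Prop :=
  | eval_Zero n : eval X Zero n 0
  | eval_Succ n : eval X Succ n n.+1
  | eval_Fst a b : eval X Fst ⟨a, b⟩ a
  | eval_Snd a b : eval X Snd ⟨a, b⟩ b
  | eval_Oracle n : eval X Oracle n (n \in X)
  | eval_Pair c d n a b :
      eval X c n a -> eval X d n b -> eval X (Pair c d) n ⟨a, b⟩
  | eval_Comp c d n k m :
      eval X d n k -> eval X c k m -> eval X (Comp c d) n m
  | eval_Prec0 c d a m :
      eval X c a m -> eval X (Prec c d) ⟨a, 0⟩ m
  | eval_PrecS c d a n r m :
      eval X (Prec c d) ⟨a, n⟩ r -> eval X d ⟨a, ⟨n, r⟩⟩ m ->
      eval X (Prec c d) ⟨a, n.+1⟩ m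
  | eval_Mu c a n (r : nat -> nat) :
      eval X c ⟨a, n⟩ 0 ->
      (forall k, k < n -> eval X c ⟨a, k⟩ (r k).+1) ->
      eval X (Mu c) a n.

Definition computable (g : nat -> nat) : Prop :=
  exists c : code, forall n, eval set0 c n (g n).

Definition ce (W : set nat) : Prop :=
  W = set0 \/ exists2 g : nat -> nat, computable g & W = range g.

Record enum_operator := EnumOperator {
  enum_set :> set nat;
  enum_set_ce : ce enum_set
}.

Definition enum_apply (Psi : enum_operator) (X : set nat) : set nat :=
  [set x | exists u, finset_of_code u `<=` X /\ (Psi : set nat) ⟨u, x⟩].

Definition turing_computes (Phi : code) (X Y : set nat) : Prop :=
  forall n, eval X Phi n (n \in Y).

Record language := Language {
  arity :> nat -> nat;
  arity_computable : computable arity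
}.

Definition structure (L : language) := forall i, set ((arity L i).-tuple nat).

Definition positive_diagram (L : language) (A : structure L) : set nat :=
  [set ⟨x, x⟩ | x in setT]
  ⊕ [set n | exists x y, n = ⟨x, y⟩ /\ x <> y]
  ⊕ bigjoin (fun i => [set tuple_code (tval t) | t in A i]).

Definition is_iso (L : language) (A B : structure L) (f : nat -> nat) : Prop :=
  bijective f /\ forall i t, A i t <-> B i (map_tuple f t).

Definition Hom (L : language) (A B : structure L) :=
  {f : nat -> nat | is_iso A B f}.

Definition iso_fun (L : language) (A B : structure L) (f : Hom A B) :
  nat -> nat := sval f.
Coercion iso_fun : Hom >-> Funclass.

Lemma is_iso_id (L : language) (A : structure L) : is_iso A A id.
Proof.
split=> [|i t]; first by exists id.
by have -> : map_tuple id t = t by apply: val_inj; rewrite /= map_id.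
Qed.

Lemma is_iso_comp (L : language) (A B C : structure L) (f g : nat -> nat) :
  is_iso B C g -> is_iso A B f -> is_iso A C (g \o f).
Proof.
move=> [bg hg] [bf hf]; split=> [|i t]; first exact: bij_comp.
have -> : map_tuple (g \o f) t = map_tuple g (map_tuple f t).
  by apply: val_inj; rewrite /= map_comp.
by rewrite hf hg.
Qed.

Definition Hom_id (L : language) (A : structure L) : Hom A A :=
  exist _ id (is_iso_id A).

Definition Hom_comp (L : language) (A B C : structure L)
    (g : Hom B C) (f : Hom A B) : Hom A C :=
  exist _ (g \o f) (is_iso_comp (svalP g) (svalP f)).

Definition obj (L : language) (C : set (structure L)) := {A | C A}.

Definition obj_structure (L : language) (C : set (structure L)) (A : obj C) :
  structure L := sval A.
Coercion obj_structure : obj >-> structure.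

Record functor (L K : language)
    (C : set (structure L)) (D : set (structure K)) := Functor {
  fobj :> obj C -> obj D;
  fmap : forall A B : obj C, Hom A B -> Hom (fobj A) (fobj B);
  fmap_id : forall A : obj C, fmap (Hom_id A) = Hom_id (fobj A);
  fmap_comp : forall (A B E : obj C) (g : Hom B E) (f : Hom A B),
    fmap (Hom_comp g f) = Hom_comp (fmap g) (fmap f)
}.

Definition positive_enumerable (L K : language)
    (C : set (structure L)) (D : set (structure K)) (F : functor C D) : Prop :=
  exists Psi Psi_star : enum_operator, forall A B : obj C,
    enum_apply Psi (positive_diagram A) = positive_diagram (F A) /\
    forall f : Hom A B,
      enum_apply Psi_star (positive_diagram A ⊕ Graph f ⊕ positive_diagram B)
      = Graph (fmap F f).

Definition positive_star_enumerable (L K : language)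
    (C : set (structure L)) (D : set (structure K)) (F : functor C D) : Prop :=
  exists (Psi : enum_operator) (Phi_star : code), forall A B : obj C,
    enum_apply Psi (positive_diagram A) = positive_diagram (F A) /\
    forall f : Hom A B,
      turing_computes Phi_star
        (positive_diagram A ⊕ Graph f ⊕ positive_diagram B)
        (Graph (fmap F f)).

(* Main.v *)
Require Import Defs.
From mathcomp Require Import all_boot.
From mathcomp Require Import boolp classical_sets.
From Stdlib Require Cantor.

(** A positive enumerable functor and its starred version use the same
    operator on structures, so only the operator on isomorphisms has to be
    replaced.  The reason it can be is that, uniformly in the oracle [X], a
    total function [h] whose graph is enumeration reducible to [X] has a graph
    that is Turing reducible to [X] ([graph_enum_decidable]).  To decide
    whether [⟨x, y⟩] is in the graph, run through the listing of the c.e. set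
    of pairs [⟨u, ⟨x', y'⟩⟩] until one turns up with [x' = x] and the finite
    set coded by [u] included in [X].  Totality of [h] makes this search halt,
    the enumeration operator puts [⟨x, y'⟩] into the graph, so [y'] is [h x],
    and the answer is whether [y' = y].  A finite set is tested for inclusion
    with finitely many questions to [X].

    What remains is to write this procedure in the given programming language.
    [ucomputable] is the class of total functionals computed by one program
    for all oracles; closing it under definition by cases, primitive recursion
    and bounded quantification yields the program without exhibiting it.  The
    only unbounded search is done once, at the end. *)

Local Open Scope classical_set_scope.
Local Open Scope nat_scope.

(** * Cantor projections *)

Definition pfst (n : nat) : nat := (Cantor.of_nat n).1.
Definition psnd (n : nat) : nat := (Cantor.of_nat n).2.

Lemma pfstE x y : pfst ⟨x, y⟩ = x.
Proof. by rewrite /pfst /pairing Cantor.cancel_of_to. Qed.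

Lemma psndE x y : psnd ⟨x, y⟩ = y.
Proof. by rewrite /psnd /pairing Cantor.cancel_of_to. Qed.

Lemma pairing_proj n : ⟨pfst n, psnd n⟩ = n.
Proof. by rewrite /pairing /pfst /psnd -surjective_pairing Cantor.cancel_to_of. Qed.

(** * Functionals computable uniformly in the oracle *)

(** The program is chosen before the oracle: this is what makes the final
    program serve all pairs of structures at once. *)
Definition ucomputable (h : set nat -> nat -> nat) : Prop :=
  exists c : code, forall X n, eval X c n (h X n).

Lemma ucomputable_zero : ucomputable (fun _ _ => 0).
Proof. by exists Zero => X n; constructor. Qed.

Lemma ucomputable_oracle : ucomputable (fun X n => n \in X).
Proof. by exists Oracle => X n; constructor. Qed.

Lemma ucomputable_comp f g :
  ucomputable f -> ucomputable g -> ucomputable (fun X n => f X (g X n)).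
Proof.
move=> [c hc] [d hd]; exists (Comp c d) => X n.
exact: eval_Comp (hd X n) (hc X _).
Qed.

Lemma ucomputable_pair f g :
  ucomputable f -> ucomputable g -> ucomputable (fun X n => ⟨f X n, g X n⟩).
Proof. by move=> [c hc] [d hd]; exists (Pair c d) => X n; constructor. Qed.

Lemma ucomputable_pfst f : ucomputable f -> ucomputable (fun X n => pfst (f X n)).
Proof.
apply: (ucomputable_comp (fun _ => pfst)); exists Fst => X n.
by rewrite -{1}(pairing_proj n); constructor.
Qed.

Lemma ucomputable_psnd f : ucomputable f -> ucomputable (fun X n => psnd (f X n)).
Proof.
apply: (ucomputable_comp (fun _ => psnd)); exists Snd => X n.
by rewrite -{1}(pairing_proj n); constructor.
Qed.

Lemma ucomputable_id : ucomputable (fun _ n => n).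
Proof.
have [c hc] : ucomputable (fun _ n => ⟨pfst n, psnd n⟩).
  apply: ucomputable_pair; [exists Fst | exists Snd] => X n;
    by rewrite -{1}(pairing_proj n); constructor.
by exists c => X n; have := hc X n; rewrite pairing_proj.
Qed.

Lemma ucomputable_succ f : ucomputable f -> ucomputable (fun X n => (f X n).+1).
Proof.
by apply: (ucomputable_comp (fun _ => succn)); exists Succ => X n; constructor.
Qed.

(** The step [s X n i r] sees the parameter [n], the stage [i] and the previous
    value [r], packed as [⟨n, ⟨i, r⟩⟩]. *)
Lemma ucomputable_iteri b k (s : set nat -> nat -> nat -> nat -> nat) :
  ucomputable b -> ucomputable k ->
  ucomputable (fun X m => s X (pfst m) (pfst (psnd m)) (psnd (psnd m))) ->
  ucomputable (fun X n => iteri (k X n) (s X n) (b X n)).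
Proof.
move=> [c hc] hk [d hd].
have [e he] := ucomputable_pair _ _ ucomputable_id hk.
exists (Comp (Prec c d) e) => X n.
apply: eval_Comp (he X n) _.
elim: (k X n) => [|i IHi] /=; first by constructor.
apply: eval_PrecS IHi _.
by have := hd X ⟨n, ⟨i, iteri i (s X n) (b X n)⟩⟩; rewrite !(pfstE, psndE).
Qed.

(** A program without oracle runs with any oracle once its queries are answered
    by the constant 0. *)
Lemma computable_ucomputable g f :
  computable g -> ucomputable f -> ucomputable (fun X n => g (f X n)).
Proof.
move=> [c hc]; apply: (ucomputable_comp (fun _ => g)).
pose fix strip (c : code) : code := match c with
  | Oracle => Zero
  | Pair c d => Pair (strip c) (strip d)
  | Comp c d => Comp (strip c) (strip d)
  | Prec c d => Prec (strip c) (strip d)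
  | Mu c => Mu (strip c)
  | c => c
  end.
exists (strip c) => X n; move: (g n) (hc n) => m.
elim=> {c n m hc} /=; try by econstructor; eauto.
by move=> n; rewrite in_set0; constructor.
Qed.

(** * Arithmetic and logic *)

(** Truth values are 0 and 1, so a conditional is a recursion of length at
    most 1. *)
Lemma ucomputable_if (b : set nat -> nat -> bool) f g :
  ucomputable (fun X n => b X n) -> ucomputable f -> ucomputable g ->
  ucomputable (fun X n => if b X n then f X n else g X n).
Proof.
move=> hb hf hg.
have [c hc] : ucomputable (fun X n => iteri (b X n) (fun _ _ => f X n) (g X n)).
  apply: (ucomputable_iteri g _ (fun X n _ _ => f X n)) => //.
  exact: ucomputable_comp hf (ucomputable_pfst _ ucomputable_id).
by exists c => X n; have := hc X n; case: (b X n).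
Qed.

Lemma ucomputable_and (a b : set nat -> nat -> bool) :
  ucomputable (fun X n => a X n) -> ucomputable (fun X n => b X n) ->
  ucomputable (fun X n => a X n && b X n).
Proof.
move=> ha hb; have [c hc] := ucomputable_if _ _ _ ha hb ucomputable_zero.
by exists c => X n; have := hc X n; case: (a X n).
Qed.

Lemma ucomputable_not (b : set nat -> nat -> bool) :
  ucomputable (fun X n => b X n) -> ucomputable (fun X n => ~~ b X n).
Proof.
move=> hb.
have [c hc] := ucomputable_if _ _ _ hb ucomputable_zero
                 (ucomputable_succ _ ucomputable_zero).
by exists c => X n; have := hc X n; case: (b X n).
Qed.

Lemma ucomputable_subn f g :
  ucomputable f -> ucomputable g -> ucomputable (fun X n => f X n - g X n).
Proof.
move=> hf hg.
have hpred h : ucomputable h -> ucomputable (fun X n => (h X n).-1).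
  apply: (ucomputable_comp (fun _ => predn)).
  have [c hc] : ucomputable (fun X n => iteri n (fun i _ => i) 0).
    apply: (ucomputable_iteri (fun _ _ => 0) _ (fun _ _ i _ => i)).
    - exact: ucomputable_zero.
    - exact: ucomputable_id.
    - exact: ucomputable_pfst (ucomputable_psnd _ ucomputable_id).
  by exists c => X n; have := hc X n; case: n.
have [c hc] :
    ucomputable (fun X n => iteri (g X n) (fun _ r => r.-1) (f X n)).
  apply: (ucomputable_iteri f _ (fun _ _ _ r => r.-1)) => //.
  by apply: hpred; do 2!apply: ucomputable_psnd; exact: ucomputable_id.
exists c => X n; have := hc X n; congr eval.
by elim: (g X n) => [|k /= ->]; rewrite ?subn0 ?subnS.
Qed.

Lemma ucomputable_eq0 f : ucomputable f -> ucomputable (fun X n => f X n == 0).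
Proof.
move=> hf.
have [c hc] := ucomputable_subn _ _ (ucomputable_succ _ ucomputable_zero) hf.
by exists c => X n; have := hc X n; case: (f X n) => // k; rewrite subSS sub0n.
Qed.

Lemma ucomputable_eq f g :
  ucomputable f -> ucomputable g -> ucomputable (fun X n => f X n == g X n).
Proof.
move=> hf hg.
have [c hc] := ucomputable_and _ _
  (ucomputable_eq0 _ (ucomputable_subn _ _ hf hg))
  (ucomputable_eq0 _ (ucomputable_subn _ _ hg hf)).
by exists c => X n; have := hc X n; rewrite !subn_eq0 -eqn_leq.
Qed.

Lemma ucomputable_odd f : ucomputable f -> ucomputable (fun X n => odd (f X n)).
Proof.
move=> hf.
have [c hc] : ucomputable (fun X n => iteri (f X n) (fun _ r => r == 0) 1).
  apply: (ucomputable_iteri (fun _ _ => 1) _ (fun _ _ _ r => r == 0)) => //.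
    exact: ucomputable_succ ucomputable_zero.
  by apply: ucomputable_eq0; do 2!apply: ucomputable_psnd; exact: ucomputable_id.
have hev : ucomputable (fun X n => ~~ odd (f X n)).
  exists c => X n; have := hc X n; congr eval.
  by elim: (f X n) => [|k /= ->] //; case: odd.
have [d hd] := ucomputable_not _ hev.
by exists d => X n; have := hd X n; rewrite negbK.
Qed.

Lemma ucomputable_half f : ucomputable f -> ucomputable (fun X n => (f X n)./2).
Proof.
move=> hf.
have [c hc] : ucomputable (fun X n =>
    iteri (f X n) (fun i r => if odd i then r.+1 else r) 0).
  apply: (ucomputable_iteri (fun _ _ => 0) _
            (fun _ _ i r => if odd i then r.+1 else r)) => //.
    exact: ucomputable_zero.
  have h2 : ucomputable (fun _ m => psnd (psnd m)).
    by do 2!apply: ucomputable_psnd; exact: ucomputable_id.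
  apply: ucomputable_if => //; last exact: ucomputable_succ.
  apply: ucomputable_odd; apply: ucomputable_pfst; apply: ucomputable_psnd.
  exact: ucomputable_id.
exists c => X n; have := hc X n; congr eval.
elim: (f X n) => [|k IHk] //; rewrite [LHS]/= IHk.
by rewrite -[k.+1./2]/(uphalf k) uphalf_half; case: odd.
Qed.

Lemma ucomputable_bit f g : ucomputable f -> ucomputable g ->
  ucomputable (fun X n => odd (f X n %/ 2 ^ g X n)).
Proof.
move=> hf hg; apply: ucomputable_odd.
have [c hc] : ucomputable (fun X n => iteri (g X n) (fun _ r => r./2) (f X n)).
  apply: (ucomputable_iteri f _ (fun _ _ _ r => r./2)) => //.
  by apply: ucomputable_half; do 2!apply: ucomputable_psnd; exact: ucomputable_id.
exists c => X n; have := hc X n; congr eval.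
elim: (g X n) => [|k IHk]; first by rewrite divn1.
by rewrite [LHS]/= IHk -divn2 -divnMA expnSr.
Qed.

Lemma ucomputable_all (p : set nat -> nat -> nat -> bool) k :
  ucomputable k -> ucomputable (fun X m => p X (pfst m) (psnd m)) ->
  ucomputable (fun X n => all (p X n) (iota 0 (k X n))).
Proof.
move=> hk hp.
have [c hc] : ucomputable (fun X n =>
    iteri (k X n) (fun i r => if p X n i then r else 0) 1).
  apply: (ucomputable_iteri (fun _ _ => 1) _
            (fun X n i r => if p X n i then r else 0)) => //.
    exact: ucomputable_succ ucomputable_zero.
  apply: ucomputable_if; last exact: ucomputable_zero.
    have [d hd] : ucomputable (fun X m =>
        p X (pfst ⟨pfst m, pfst (psnd m)⟩) (psnd ⟨pfst m, pfst (psnd m)⟩)).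
      apply: (ucomputable_comp _ (fun _ m => ⟨pfst m, pfst (psnd m)⟩) hp).
      apply: ucomputable_pair; first exact: ucomputable_pfst ucomputable_id.
      exact: ucomputable_pfst (ucomputable_psnd _ ucomputable_id).
    by exists d => X m; have := hd X m; rewrite pfstE psndE.
  by do 2!apply: ucomputable_psnd; exact: ucomputable_id.
exists c => X n; have := hc X n; congr eval.
elim: (k X n) => [|i IHi] //; rewrite -addn1 iotaD all_cat addn1 /= IHi andbT.
by case: (p X n i); rewrite ?andbT ?andbF.
Qed.

(** * Deciding inclusion of coded finite sets *)

(** Querying numbers below [u] suffices, because [i < 2 ^ i] and the bit [2 ^ i]
    can only occur in [u] when [2 ^ i <= u]. *)
Definition finset_subb (u : nat) (X : set nat) : bool :=
  all (fun i => ~~ (odd (u %/ 2 ^ i) && ~~ (i \in X))) (iota 0 u).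

Lemma finset_subbP u X : reflect (finset_of_code u `<=` X) (finset_subb u X).
Proof.
apply: (iffP allP) => [H i /= hi|H i _].
  suff: i \in iota 0 u by move/H; rewrite hi /= negbK => /set_mem.
  rewrite mem_iota /= add0n ltnNge; apply/negP => le_ui.
  have : odd (u %/ 2 ^ i) by [].
  by rewrite divn_small // (leq_ltn_trans le_ui) // ltn_expl.
by apply/negP => /andP[/H /mem_set ->].
Qed.

Lemma ucomputable_finset_subb f :
  ucomputable f -> ucomputable (fun X n => finset_subb (f X n) X).
Proof.
move=> hf.
apply: (ucomputable_all (fun X n i => ~~ (odd (f X n %/ 2 ^ i) && ~~ (i \in X))))
  => //.
have hsnd : ucomputable (fun _ m => psnd m).
  exact: ucomputable_psnd ucomputable_id.
apply: ucomputable_not; apply: ucomputable_and.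
  apply: ucomputable_bit => //.
  exact: ucomputable_comp hf (ucomputable_pfst _ ucomputable_id).
apply: (ucomputable_not (fun X m => psnd m \in X)).
exact: ucomputable_comp ucomputable_oracle hsnd.
Qed.

(** * Unbounded search and the graph of an enumerated function *)

(** For an arbitrary oracle the search may find no witness and diverge, so it is
    not a [ucomputable] functional and its correctness is conditional. *)
Lemma unbounded_search (p : set nat -> nat -> nat -> bool) :
  ucomputable (fun X m => p X (pfst m) (psnd m)) ->
  exists c : code, forall X n, (exists s, p X n s) ->
    exists2 s, p X n s & eval X c n s.
Proof.
move=> /ucomputable_not[c hc]; exists (Mu c) => X n ex_s.
case: (ex_minnP ex_s) => s ps min_s; exists s => //.
apply: (eval_Mu (r := fun=> 0)) => [|k lt_ks].
  by have := hc X ⟨n, s⟩; rewrite pfstE psndE ps.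
have := hc X ⟨n, k⟩; rewrite pfstE psndE; case: (boolP (p X n k)) => //.
by move/min_s; rewrite leqNgt lt_ks.
Qed.

Lemma in_Graph h n : (n \in Graph h) = (h (pfst n) == psnd n).
Proof.
apply/idP/eqP => [/set_mem[x [y [-> <-]]]|hn]; first by rewrite pfstE psndE.
by apply: mem_set; exists (pfst n), (psnd n); rewrite pairing_proj.
Qed.

(** Single-valuedness of the graph turns enumeration into decision: the first
    value enumerated for an argument is its only one. *)
Lemma graph_enum_decidable (Psi : enum_operator) :
  exists Phi : code, forall (X : set nat) (h : nat -> nat),
    enum_apply Psi X = Graph h -> turing_computes Phi X (Graph h).
Proof.
case: (enum_set_ce Psi) => [Psi0|[g g_comp Psi_g]].
  (* The empty operator enumerates no graph of a total function. *)
  exists Zero => X h Xh n; have : Graph h ⟨0, h 0⟩ by exists 0, (h 0).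
  by rewrite -Xh => -[u [_]]; rewrite Psi0.
(* [g s] is read as ⟨u, ⟨x, y⟩⟩: if u codes a subset of X, then y is the value
   at x. *)
have hg f : ucomputable f -> ucomputable (fun X n => g (f X n)).
  exact: computable_ucomputable.
have hs : ucomputable (fun _ m => g (psnd m)).
  exact: hg (ucomputable_psnd _ ucomputable_id).
have hn : ucomputable (fun _ m => pfst m).
  exact: ucomputable_pfst ucomputable_id.
pose p X n s := (pfst (psnd (g s)) == pfst n) && finset_subb (pfst (g s)) X.
have [c hc] : exists c : code, forall X n, (exists s, p X n s) ->
    exists2 s, p X n s & eval X c n s.
  apply: unbounded_search; apply: ucomputable_and.
    apply: ucomputable_eq; last exact: ucomputable_pfst hn.
    exact: ucomputable_pfst (ucomputable_psnd _ hs).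
  exact: ucomputable_finset_subb (ucomputable_pfst _ hs).
have [d hd] : ucomputable (fun _ m => psnd (psnd (g (psnd m))) == psnd (pfst m)).
  apply: ucomputable_eq; last exact: ucomputable_psnd hn.
  by do 2!apply: ucomputable_psnd.
have [e he] := ucomputable_id.
exists (Comp d (Pair e c)) => X h Xh n.
have ex_s : exists s, p X n s.
  have : Graph h ⟨pfst n, h (pfst n)⟩ by exists (pfst n), (h (pfst n)).
  rewrite -Xh => -[u [/finset_subbP uX]]; rewrite Psi_g => -[s _ gs].
  by exists s; rewrite /p gs !(pfstE, psndE) eqxx.
have [s /andP[/eqP gs_x /finset_subbP gs_X] c_s] := hc X n ex_s.
have gs_y : psnd (psnd (g s)) = h (pfst n).
  have : enum_apply Psi X (psnd (g s)).
    by exists (pfst (g s)); split => //; rewrite pairing_proj Psi_g; exists s.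
  by rewrite Xh => /mem_set; rewrite in_Graph gs_x => /eqP ->.
apply: eval_Comp (eval_Pair (he X n) c_s) _.
by have := hd X ⟨n, s⟩; rewrite pfstE psndE gs_y in_Graph.
Qed.

Theorem proposition22 (L K : language)
    (C : set (structure L)) (D : set (structure K)) (F : functor C D) :
  positive_enumerable F -> positive_star_enumerable F.
Proof.
move=> [Psi [Psi_star H]].
have [Phi hPhi] := graph_enum_decidable Psi_star.
exists Psi, Phi => A B; have [HA Hf] := H A B; split=> // f.
exact: hPhi (Hf f).
Qed.
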